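(* Let $\rho^{AB}=\{\rho_n^{AB}\}_{n\ge1}$ be a sequence of bipartite states on $\mathcal{H}_A^{(n)}\otimes\mathcal{H}_B^{(n)}$ with $\dim\mathcal{H}_A^{(n)}=d^n$, shared between a sender (holding $A$) and a receiver (holding $B$), where the sender may transmit system $A$ through a noiseless channel. The dense coding capacity is \[ C_{DC}=\log d-\inf_{\Lambda}\overline{S}(\Lambda A|B), \] where the infimum is over sequences $\Lambda=\{\Lambda_n^A\}$ of CPTP maps on $\mathcal{B}(\mathcal{H}_A^{(n)})$ and $\overline{S}(\Lambda A|B)$ is the conditional spectral sup-entropy rate of the sequence $\rho_n^{\Lambda AB}:=(\Lambda^A_n\otimes\mathrm{id}^B)\rho_n^{AB}$.
   Context: Logarithms are natural. For self-adjoint $A=\sum_i\lambda_i|i\rangle\langle i|$, $\{A\ge0\}:=\sum_{\lambda_i\ge0}|i\rangle\langle i|$ and $\{A\ge B\}:=\{A-B\ge0\}$. For a sequence of bipartite states $\tau=\{\tau_n^{AB}\}$ with $B$-marginals $\tau_n^B$, the conditional spectral sup-entropy rate is \[ \overline{S}(A|B)=\inf\Big\{\gamma:\ \liminf_{n\to\infty}\mathrm{Tr}\big[\{\tau_n^{AB}\ge e^{-n\gamma}I^A_n\otimes\tau_n^B\}(\tau_n^{AB}-e^{-n\gamma}I^A_n\otimes\tau_n^B)\big]=1\Big\}. \] A dense coding code $\mathcal{C}^{(n)}$ of size $M_n$ consists of CPTP maps $\mathcal{E}^A_{n,i}$ on $\mathcal{B}(\mathcal{H}_A^{(n)})$, $i=1,\dots,M_n$,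 giving codewords $\rho^{AB}_{n,i}=(\mathcal{E}^A_{n,i}\otimes\mathrm{id}^B)\rho_n^{AB}$, and positive operators $E^{AB}_{n,i}$ on $\mathcal{H}_A^{(n)}\otimes\mathcal{H}_B^{(n)}$ with $\sum_iE^{AB}_{n,i}\le I$; its average error probability is $P_e(\mathcal{C}^{(n)})=\frac1{M_n}\sum_{i=1}^{M_n}(1-\mathrm{Tr}(\rho^{AB}_{n,i}E^{AB}_{n,i}))$. A rate $R$ is achievable if there are codes with $M_n\ge e^{nR}$ for all sufficiently large $n$ and $P_e(\mathcal{C}^{(n)})\to0$; $C_{DC}$ is the supremum of achievable rates. *)

(* Defs.v *)
From mathcomp Require Import all_boot all_algebra.
From mathcomp Require Import complex spectral.
From mathcomp Require Import all_classical all_reals all_analysis.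
Unset Printing Implicit Defensive.
Import GRing.Theory Num.Theory numFieldNormedType.Exports.
Local Open Scope classical_set_scope.
Local Open Scope ring_scope.

Section QDefs.
Context {R : realType}.
Local Notation C := R[i].

(* Tensor index conventions: 'I_(a*b) ~ 'I_a * 'I_b via mathcomp's mxvec_index. *)
Definition pidx {a b : nat} (i : 'I_a) (j : 'I_b) : 'I_(a * b) := mxvec_index i j.
Definition unpair {a b : nat} (p : 'I_(a * b)) : 'I_a * 'I_b :=
  enum_val (cast_ord (esym (mxvec_cast a b)) p).

Definition psd {n : nat} (A : 'M[C]_n) : Prop :=
  forall v : 'cV[C]_n, 0 <= ((map_mx Num.conj v)^T *m A *m v) 0 0.

Definition is_state {n : nat} (A : 'M[C]_n) : Prop := psd A /\ \tr A = 1.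

Definition blockmx {a k : nat} (X : 'M[C]_(a * k)) (s t : 'I_k) : 'M[C]_a :=
  \matrix_(i, j) X (pidx i s) (pidx j t).
Definition lift_id {a : nat} (Phi : 'M[C]_a -> 'M[C]_a) (k : nat)
  (X : 'M[C]_(a * k)) : 'M[C]_(a * k) :=
  \matrix_(p, q) Phi (blockmx X (unpair p).2 (unpair q).2) (unpair p).1 (unpair q).1.

Definition is_linear_map {a : nat} (Phi : 'M[C]_a -> 'M[C]_a) : Prop :=
  forall (c : C) (X Y : 'M[C]_a), Phi (c *: X + Y) = c *: Phi X + Phi Y.
Definition completely_positive {a : nat} (Phi : 'M[C]_a -> 'M[C]_a) : Prop :=
  forall (k : nat) (X : 'M[C]_(a * k)), psd X -> psd (lift_id Phi k X).
Definition trace_preserving {a : nat} (Phi : 'M[C]_a -> 'M[C]_a) : Prop :=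
  forall X : 'M[C]_a, \tr (Phi X) = \tr X.
Definition CPTP {a : nat} (Phi : 'M[C]_a -> 'M[C]_a) : Prop :=
  [/\ is_linear_map Phi, completely_positive Phi & trace_preserving Phi].

Definition ptrA {a b : nat} (X : 'M[C]_(a * b)) : 'M[C]_b :=
  \matrix_(s, t) \sum_(i < a) X (pidx i s) (pidx i t).
Definition idtens (a : nat) {b : nat} (Y : 'M[C]_b) : 'M[C]_(a * b) :=
  \matrix_(p, q) (if (unpair p).1 == (unpair q).1
                  then Y (unpair p).2 (unpair q).2 else 0).

Definition posproj {n : nat} (A : 'M[C]_n) : 'M[C]_n :=
  invmx (spectralmx A)
  *m diag_mx (\row_i (if 0 <= spectral_diag A 0 i then 1 else 0))
  *m spectralmx A.

Definition sup_entropy_rate (dA dB : nat -> nat)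
  (tau : forall n, 'M[C]_(dA n * dB n)) : \bar R :=
  let X n (g : R) := tau n - (Complex (expR (- (n%:R * g))) 0) *: idtens (dA n) (ptrA (tau n)) in
  ereal_inf [set (g%:E)%E | g in
    [set g : R | limn_einf (fun n => (complex.Re (\tr (posproj (X n g) *m X n g)))%:E)
                 = 1%E]].

Definition avg_error {a b M : nat} (rho : 'M[C]_(a * b))
  (enc : 'I_M -> 'M[C]_a -> 'M[C]_a) (dec : 'I_M -> 'M[C]_(a * b)) : R :=
  (M%:R)^-1 * \sum_(i < M) (1 - complex.Re (\tr (lift_id (enc i) b rho *m dec i))).

Definition achievable_rate (d : nat) (dB : nat -> nat)
  (rho : forall n, 'M[C]_(d ^ n * dB n)) (r : R) : Prop :=
  exists (M : nat -> nat)
         (enc : forall n, 'I_(M n) -> 'M[C]_(d ^ n) -> 'M[C]_(d ^ n))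
         (dec : forall n, 'I_(M n) -> 'M[C]_(d ^ n * dB n)),
    [/\ (forall n i, CPTP (enc n i)),
        (forall n i, psd (dec n i)),
        (forall n, psd (1%:M - \sum_(i < M n) dec n i)),
        (\forall n \near \oo, expR (n%:R * r) <= (M n)%:R) &
        ((fun n => avg_error (rho n) (enc n) (dec n)) @ \oo --> (0 : R))].

Definition dense_coding_capacity (d : nat) (dB : nat -> nat)
  (rho : forall n, 'M[C]_(d ^ n * dB n)) : \bar R :=
  ereal_sup [set (r%:E)%E | r in achievable_rate d dB rho].

End QDefs.

(* Main.v *)
(* Write X(g) = tau - e^(-n g) I (x) tau_B and P = {X(g) >= 0}.

   Converse: P maximizes tr(X(g) E) over 0 <= E <= 1. Averaging this over the
   codewords of a code of size M, whose B-marginals all equal rho_B, gives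
   1 - P_e - e^(-n g) d^n / M <= tr(X(g) P) for the best encoder, which serves
   as Lambda_n; with g = log d - R + delta the correction is at most e^(-n delta).

   Direct part: the codewords are U_i tau U_i^* and the tests P_i = U_i P U_i^*,
   for unitaries U_i in a finite group whose twirl sends tau to (I / d^n) (x) tau_B.
   The average over the group of tr(U tau U^* sum_(j < i) P_j) is at most
   i e^(n g) / d^n, so U_i can be chosen greedily below it. The receiver applies
   the tests P_0, P_1, ... in turn and stops at the first success; the quantum
   union bound 1 - F^* F <= 4 sum_j (1 - Q_j), for F = Q_k ... Q_0 a product of
   projections, bounds the error by 4 (1 - tr(X(g) P) + M e^(n g) / d^n). *)
Require Import Defs.
From mathcomp Require Import all_boot all_order all_algebra fingroup perm.
From mathcomp Require Import complex spectral sesquilinear.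
From mathcomp Require Import all_classical all_reals all_analysis.
From mathcomp Require Import ring lra.
Import Order.TTheory GRing.Theory Num.Theory numFieldNormedType.Exports.
Local Open Scope classical_set_scope.
Set Implicit Arguments.
Unset Strict Implicit.
Unset Printing Implicit Defensive.
Local Open Scope ring_scope.

(** * Positive semidefinite matrices, projections and spectral decomposition *)

Section PositiveMatrices.
Context {R : realType}.
Local Notation C := R[i].
Local Open Scope sesquilinear_scope.

Lemma conjmx_mul (m n p : nat) (A : 'M[C]_(m, n)) (B : 'M[C]_(n, p)) :
  (A *m B)^t* = B^t* *m A^t*.
Proof. by rewrite trmx_mul map_mxM. Qed.

Lemma conjmx_add (m n : nat) (A B : 'M[C]_(m, n)) : (A + B)^t* = A^t* + B^t*.
Proof. by rewrite linearD map_mxD. Qed.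

Lemma conjmx_sub (m n : nat) (A B : 'M[C]_(m, n)) : (A - B)^t* = A^t* - B^t*.
Proof. by rewrite linearB map_mxB. Qed.

Lemma conjmx_1 (n : nat) : (1%:M : 'M[C]_n)^t* = 1%:M.
Proof. by rewrite trmx1 map_mx1. Qed.

Lemma conjmx_entry (m n : nat) (A : 'M[C]_(m, n)) (i : 'I_n) (j : 'I_m) :
  (A^t*) i j = (A j i)^*.
Proof. by rewrite !mxE. Qed.

Lemma psdP (n : nat) (A : 'M[C]_n) :
  psd A <-> forall v : 'cV[C]_n, 0 <= (v^t* *m A *m v) 0 0.
Proof. by split=> H v; have := H v; rewrite map_trmx. Qed.

Lemma psd_congr (m n : nat) (B : 'M[C]_(n, m)) (A : 'M[C]_n) :
  psd A -> psd (B^t* *m A *m B).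
Proof.
move=> /psdP HA; apply/psdP => v; have := HA (B *m v).
by rewrite conjmx_mul !mulmxA.
Qed.

Lemma psd_1 (n : nat) : psd (1%:M : 'M[C]_n).
Proof.
apply/psdP => v; rewrite mulmx1 mxE sumr_ge0 // => i _.
by rewrite conjmx_entry mulrC mul_conjC_ge0.
Qed.

Lemma psd_0 (n : nat) : psd (0 : 'M[C]_n).
Proof. by apply/psdP => v; rewrite mulmx0 mul0mx mxE. Qed.

Lemma psd_gram (m n : nat) (B : 'M[C]_(n, m)) : psd (B^t* *m B).
Proof. by rewrite -[X in X *m _]mulmx1; apply/psd_congr/psd_1. Qed.

Lemma psd_add (n : nat) (A B : 'M[C]_n) : psd A -> psd B -> psd (A + B).
Proof.
move=> /psdP HA /psdP HB; apply/psdP => v.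
by rewrite mulmxDr mulmxDl mxE addr_ge0.
Qed.

Lemma psd_scale (n : nat) (c : C) (A : 'M[C]_n) :
  0 <= c -> psd A -> psd (c *: A).
Proof.
move=> c0 /psdP HA; apply/psdP => v.
by rewrite -scalemxAr -scalemxAl mxE mulr_ge0.
Qed.

Lemma psd_sum (n : nat) (I : Type) (r : seq I) (P : pred I) (A : I -> 'M[C]_n) :
  (forall i, P i -> psd (A i)) -> psd (\sum_(i <- r | P i) A i).
Proof.
by move=> H; apply: (big_ind psd); [exact: psd_0 | exact: psd_add |].
Qed.

Lemma psd_diag_ge0 (n : nat) (i : 'I_n) (A : 'M[C]_n) : psd A -> 0 <= A i i.
Proof.
move=> /psdP/(_ (delta_mx i 0)).
rewrite trmx_delta map_delta_mx -rowE -colE !mxE //.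
Qed.

(** Polarization: expanding at [u + v] gives [b u v + b v u = 0], and putting ['i *: v] for [v]
    gives [b u v = b v u], so both vanish. *)
Lemma quadratic_form_eq0 (n : nat) (B : 'M[C]_n) :
  (forall v : 'cV[C]_n, v^t* *m B *m v = 0) -> B = 0.
Proof.
move=> q0; apply/matrixP => i j.
pose b (u v : 'cV[C]_n) := u^t* *m B *m v.
have bD (u v : 'cV[C]_n) : b u v + b v u = 0.
  have := q0 (u + v); rewrite conjmx_add mulmxDl mulmxDl !mulmxDr.
  by rewrite (q0 u) (q0 v) add0r addr0.
have bZr (u v : 'cV[C]_n) : b u ('i *: v) = 'i *: b u v.
  by rewrite /b -scalemxAr.
have bZl (u v : 'cV[C]_n) : b ('i *: v) u = - ('i *: b v u).
  by rewrite /b linearZ /= map_mxZ -!scalemxAl -scaleNr -conjCi.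
have b0 (u v : 'cV[C]_n) : b u v = 0.
  have := bD u ('i *: v); rewrite bZr bZl -scalerBr => /eqP.
  rewrite scalemx_eq0 (negPf (neq0Ci _)) /= subr_eq0 => /eqP uv.
  have := bD u v; rewrite -uv -mulr2n -scaler_nat => /eqP.
  by rewrite scalemx_eq0 pnatr_eq0 /= => /eqP.
have := b0 (delta_mx i 0) (delta_mx j 0).
rewrite /b trmx_delta map_delta_mx -rowE -colE => /matrixP/(_ 0 0).
by rewrite !mxE.
Qed.

(** A nonnegative quadratic form is real, so [A] and its adjoint have the same form, and
    polarization makes them equal. *)
Lemma psd_herm (n : nat) (A : 'M[C]_n) : psd A -> A^t* = A.
Proof.
move=> /psdP HA; apply/esym/eqP; rewrite -subr_eq0; apply/eqP.
apply: quadratic_form_eq0 => v; apply/matrixP => i j; rewrite !ord1.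
rewrite mulmxBr mulmxBl.
have -> : v^t* *m A^t* *m v = (v^t* *m A *m v)^t*.
  by rewrite !conjmx_mul trmxCK mulmxA.
by rewrite !mxE (geC0_conj _) ?subrr //; have := HA v; rewrite mxE.
Qed.

Lemma conjmx_hermsym (n : nat) (A : 'M[C]_n) : A^t* = A -> A \is hermsymmx.
Proof. by move=> hA; apply/is_hermitianmxP; rewrite expr0 scale1r hA. Qed.

Lemma spectral_mulmxV (n : nat) (A : 'M[C]_n) :
  spectralmx A *m (spectralmx A)^t* = 1%:M.
Proof. exact/unitarymxP/spectral_unitarymx. Qed.

Lemma spectral_decomp (n : nat) (A : 'M[C]_n) : A^t* = A ->
  A = (spectralmx A)^t* *m diag_mx (spectral_diag A) *m spectralmx A.
Proof.
move=> /conjmx_hermsym/hermitian_normalmx/orthomx_spectralP.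
by rewrite invmx_unitary // spectral_unitarymx.
Qed.

Lemma trace_spectral (n : nat) (A E : 'M[C]_n) (r : 'rV[C]_n) :
  \tr ((spectralmx A)^t* *m diag_mx r *m spectralmx A *m E)
  = \sum_k r 0 k * (spectralmx A *m E *m (spectralmx A)^t*) k k.
Proof.
rewrite -[X in \tr X]mulmxA -[X in \tr X]mulmxA mxtrace_mulC -[X in \tr X]mulmxA.
by apply: eq_bigr => k _; rewrite mul_diag_mx mxE.
Qed.

Lemma psd_spectral_conj (n : nat) (A E : 'M[C]_n) :
  psd E -> psd (spectralmx A *m E *m (spectralmx A)^t*).
Proof. by move=> /(psd_congr ((spectralmx A)^t*)); rewrite trmxCK. Qed.

(** In an eigenbasis of [A] the trace is a sum of eigenvalues of [A] times diagonal entries of [B],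
    all nonnegative. *)
Lemma psd_trace_mul_ge0 (n : nat) (A B : 'M[C]_n) :
  psd A -> psd B -> 0 <= \tr (A *m B).
Proof.
move=> HA HB; have hA := psd_herm HA; rewrite (spectral_decomp hA).
rewrite trace_spectral; apply: sumr_ge0 => k _; apply: mulr_ge0; last first.
  exact/psd_diag_ge0/psd_spectral_conj.
have := psd_diag_ge0 k (psd_spectral_conj A HA).
rewrite {2}(spectral_decomp hA) !mulmxA spectral_mulmxV mul1mx.
by rewrite -mulmxA spectral_mulmxV mulmx1 mxE eqxx mulr1n.
Qed.

Definition is_proj (n : nat) (P : 'M[C]_n) : Prop := P^t* = P /\ P *m P = P.

Lemma proj_psd (n : nat) (P : 'M[C]_n) : is_proj P -> psd P.
Proof. by case=> h e; rewrite -e -{1}h; apply: psd_gram. Qed.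

Lemma proj_compl (n : nat) (P : 'M[C]_n) : is_proj P -> is_proj (1%:M - P).
Proof.
case=> h e; split; first by rewrite conjmx_sub conjmx_1 h.
by rewrite mulmxBl !mulmxBr !mulmx1 mul1mx e subrr subr0.
Qed.

Lemma posprojE (n : nat) (A : 'M[C]_n) : posproj A =
  (spectralmx A)^t* *m diag_mx (\row_i (if 0 <= spectral_diag A 0 i then 1 else 0))
  *m spectralmx A.
Proof. by rewrite /posproj invmx_unitary // spectral_unitarymx. Qed.

Lemma posproj_proj (n : nat) (A : 'M[C]_n) : is_proj (posproj A).
Proof.
rewrite posprojE; set r := \row_i _; split.
  rewrite !conjmx_mul trmxCK mulmxA tr_diag_mx map_diag_mx.
  congr (_ *m diag_mx _ *m _); apply/rowP => i; rewrite !mxE.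
  by case: ifP; rewrite ?rmorph1 ?rmorph0.
rewrite !mulmxA -(mulmxA _ (spectralmx A)) spectral_mulmxV mulmx1.
rewrite -(mulmxA _ (diag_mx r) (diag_mx r)) mulmx_diag.
congr (_ *m diag_mx _ *m _).
by apply/rowP => i; rewrite !mxE; case: ifP; rewrite ?mulr1 ?mulr0.
Qed.

(** In an eigenbasis of [A] the diagonal entries of [E] lie in [0, 1]; an eigenvalue weighted by
    such an entry is at most its positive part, and [posproj A] attains this for every
    eigenvalue. *)
Lemma trace_le_posproj (n : nat) (A E : 'M[C]_n) : A^t* = A ->
  psd E -> psd (1%:M - E) -> \tr (A *m E) <= \tr (posproj A *m A).
Proof.
move=> hA HE HE1.
have -> : \tr (posproj A *m A)
    = \sum_k (if 0 <= spectral_diag A 0 k then 1 else 0) * spectral_diag A 0 k.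
  rewrite posprojE trace_spectral; apply: eq_bigr => k _; rewrite mxE.
  rewrite {3}(spectral_decomp hA) !mulmxA spectral_mulmxV mul1mx.
  by rewrite -mulmxA spectral_mulmxV mulmx1 [in X in _ * X]mxE eqxx mulr1n.
rewrite {1}(spectral_decomp hA) trace_spectral; apply: ler_sum => k _.
have e0 := psd_diag_ge0 k (psd_spectral_conj A HE).
have := psd_diag_ge0 k (psd_spectral_conj A HE1).
rewrite mulmxBr mulmxBl mulmx1 spectral_mulmxV.
move: (_ *m E *m _) e0 => F F0; rewrite !mxE eqxx subr_ge0 => F1.
have lr : spectral_diag A 0 k \is Num.real.
  by move: (hermitian_spectral_diag_real (conjmx_hermsym hA)) => /mxOverP; apply.
case: ifPn => [l0|]; first by rewrite mul1r ler_piMr.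
by rewrite -real_ltNge ?real0// => /ltW l0; rewrite mul0r mulr_le0_ge0.
Qed.

End PositiveMatrices.

(** * Sequential projective tests and the quantum union bound *)

Section SequentialMeasurement.
Context {R : realType}.
Local Notation C := R[i].
Local Open Scope sesquilinear_scope.

(* Kraus operator of the event that the tests [P 0], ..., [P k.-1], applied in
   this order, all fail. *)
Fixpoint seqmx (n : nat) (P : nat -> 'M[C]_n) (k : nat) : 'M[C]_n :=
  if k is k'.+1 then (1%:M - P k') *m seqmx P k' else 1%:M.

(** Measurement operator of the outcome that test [i] is the first to succeed. *)
Definition seqdec (n : nat) (P : nat -> 'M[C]_n) (i : nat) : 'M[C]_n :=
  (seqmx P i)^t* *m P i *m seqmx P i.

(** Telescoping: since [1 - P k] is a projection, [seqdec P k] is the drop of [F^* F] from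
    [F = seqmx P k] to [F = seqmx P k.+1]. *)
Lemma sum_seqdec (n : nat) (P : nat -> 'M[C]_n) (k : nat) :
  (forall i, is_proj (P i)) ->
  \sum_(i < k) seqdec P i = 1%:M - (seqmx P k)^t* *m seqmx P k.
Proof.
move=> HP; elim: k => [|k IH].
  by rewrite big_ord0 /= conjmx_1 mulmx1 subrr.
rewrite big_ord_recr IH /= conjmx_mul.
have [hQ eQ] := proj_compl (HP k).
rewrite hQ !mulmxA -(mulmxA _ (1%:M - P k) (1%:M - P k)) eQ mulmxBr mulmx1 mulmxBl.
by rewrite /seqdec opprB addrA addrAC.
Qed.

Lemma psd_seqdec (n : nat) (P : nat -> 'M[C]_n) (i : nat) :
  (forall i, is_proj (P i)) -> psd (seqdec P i).
Proof. by move=> HP; apply/psd_congr/proj_psd. Qed.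

Lemma psd_sum_seqdec (n : nat) (P : nat -> 'M[C]_n) (k : nat) :
  (forall i, is_proj (P i)) -> psd (1%:M - \sum_(i < k) seqdec P i).
Proof. by move=> HP; rewrite sum_seqdec// opprB addrC subrK; apply: psd_gram. Qed.

(* Strengthening of the union bound [1 - F^* F <= 4 S] that is stable under
   [F := Q F] and [S := S + (1 - Q)]: the gap grows by [(2 - F)^* (1 - Q) (2 - F)]. *)
Definition union_gap (n : nat) (S F : 'M[C]_n) : 'M[C]_n :=
  4%:R *: S - (1%:M - F^t* *m F) - 2%:R *: ((1%:M - F)^t* *m (1%:M - F)).

(* Entrywise form of [union_gap_step], with [a = F^* G F], [b = F^* F],
   [c = F^* G], [e = G F], [o = 1] and [f' = F^*]. *)
Lemma union_gap_ring (K : comPzRingType) (s g o a b c e f f' : K) :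
  4%:R * (s + g) - (o - (b - a - (a - a)))
    - 2%:R * (o - (f - e) - (f' - (b - a) - (c - (a - a)))) =
  4%:R * s - (o - b) - 2%:R * (o - f - (f' - b))
    + (2%:R * (2%:R * g - c) - (2%:R * e - a)).
Proof. ring. Qed.

Lemma union_gap_step (n : nat) (S F G : 'M[C]_n) : is_proj G ->
  union_gap (S + G) ((1%:M - G) *m F)
  = union_gap S F + (2%:R%:M - F)^t* *m G *m (2%:R%:M - F).
Proof.
move=> [hG eG].
have GGF : G *m (G *m F) = G *m F by rewrite mulmxA eG.
have h2 : (2%:R%:M : 'M[C]_n)^t* = 2%:R%:M.
  by rewrite tr_scalar_mx map_scalar_mx rmorph_nat.
rewrite /union_gap !conjmx_sub h2 !conjmx_mul !conjmx_sub !conjmx_1 hG.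
rewrite !(mulmxBl, mulmxBr, mulmx1, mul1mx, mul_scalar_mx, mul_mx_scalar).
rewrite -!scalemxAl -!mulmxA !GGF.
(* With the products turned into atoms the identity is linear in them, so it can be checked entry by
   entry in a commutative ring. *)
move: (F^t* *m (G *m F)) (F^t* *m F) (F^t* *m G) => a b c.
move: (G *m F) (F^t*) (1%:M : 'M[C]_n) => e f o.
apply/matrixP => i j; rewrite ![in LHS]mxE ![in RHS]mxE; exact: union_gap_ring.
Qed.

Lemma union_gap_psd (n : nat) (P : nat -> 'M[C]_n) (k : nat) :
  (forall i, is_proj (P i)) -> psd (union_gap (\sum_(i < k) P i) (seqmx P k)).
Proof.
move=> HP; elim: k => [|k IH].
  rewrite big_ord0 /union_gap /= conjmx_1 mulmx1 subrr mulmx0 !scaler0 !subr0.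
  exact: psd_0.
rewrite big_ord_recr /= union_gap_step//; apply: psd_add => //.
exact/psd_congr/proj_psd.
Qed.

(** Success of test [i] after [i] failures is again a product of projections: its last factor is
    [P i = 1 - (1 - P i)], so one more [union_gap_step] with [G = 1 - P i] covers it. *)
Lemma seqdec_union_bound (n : nat) (P : nat -> 'M[C]_n) (i : nat) :
  (forall i, is_proj (P i)) ->
  psd (4%:R *: (\sum_(j < i) P j + (1%:M - P i)) - (1%:M - seqdec P i)).
Proof.
move=> HP; have HQ := proj_compl (HP i).
have step := union_gap_step (\sum_(j < i) P j) (seqmx P i) HQ.
have := psd_add (union_gap_psd i HP)
  (psd_congr (2%:R%:M - seqmx P i) (proj_psd HQ)).
rewrite -step (subKr 1%:M) => gap.
(* Adding back the square that [union_gap] subtracts leaves the plain union bound. *)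
have := psd_add gap (psd_scale (ler0n C 2)
  (psd_gram (1%:M - P i *m seqmx P i))).
have [hP eP] := HP i.
rewrite /union_gap /seqdec subrK !conjmx_mul hP !mulmxA.
by rewrite -(mulmxA _ (P i) (P i)) eP.
Qed.
End SequentialMeasurement.

(** * Tensor products, partial trace and CPTP maps on the first factor *)

Section TensorIndices.
Context {R : realType}.
Local Notation C := R[i].
Local Open Scope sesquilinear_scope.

Lemma pidxK (a b : nat) (i : 'I_a) (s : 'I_b) : unpair (pidx i s) = (i, s).
Proof. by rewrite /unpair /pidx /mxvec_index cast_ordK enum_rankK. Qed.

Lemma unpairK (a b : nat) (p : 'I_(a * b)) : pidx (unpair p).1 (unpair p).2 = p.
Proof. by case/mxvec_indexP: p => i s; rewrite (pidxK i s). Qed.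

Lemma sum_pidx (V : nmodType) (a b : nat) (F : 'I_(a * b) -> V) :
  \sum_p F p = \sum_i \sum_s F (pidx i s).
Proof.
rewrite pair_bigA /= (reindex (fun x : 'I_a * 'I_b => pidx x.1 x.2)) //=.
exists unpair => [[i s] _|p _] /=; [exact: pidxK | exact: unpairK].
Qed.

Lemma tensor_matrixP (a b : nat) (X Y : 'M[C]_(a * b)) :
  (forall i j s t, X (pidx i s) (pidx j t) = Y (pidx i s) (pidx j t)) -> X = Y.
Proof.
move=> H; apply/matrixP => p q; rewrite -(unpairK p) -(unpairK q); exact: H.
Qed.

Lemma lift_idE (a k : nat) (Phi : 'M[C]_a -> 'M[C]_a) (X : 'M[C]_(a * k)) i j s t :
  lift_id Phi k X (pidx i s) (pidx j t) = Phi (blockmx X s t) i j.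
Proof. by rewrite mxE !pidxK. Qed.

Lemma idtensE (a k : nat) (Y : 'M[C]_k) i j s t :
  idtens a Y (pidx i s) (pidx j t) = if i == j then Y s t else 0.
Proof. by rewrite mxE !pidxK. Qed.

Lemma blockmx_lift_id (a k : nat) (Phi : 'M[C]_a -> 'M[C]_a) (X : 'M[C]_(a * k)) s t :
  blockmx (lift_id Phi k X) s t = Phi (blockmx X s t).
Proof. by apply/matrixP => i j; rewrite mxE lift_idE. Qed.

Lemma blockmx_idtens (a k : nat) (Y : 'M[C]_k) s t :
  blockmx (idtens a Y) s t = (Y s t)%:M.
Proof. by apply/matrixP => i j; rewrite [LHS]mxE idtensE mxE; case: eqP. Qed.

Lemma ptrA_block (a k : nat) (X : 'M[C]_(a * k)) s t :
  ptrA X s t = \tr (blockmx X s t).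
Proof. by rewrite mxE; apply: eq_bigr => i _; rewrite mxE. Qed.

Lemma trace_ptrA (a k : nat) (X : 'M[C]_(a * k)) : \tr (ptrA X) = \tr X.
Proof.
rewrite [RHS]/mxtrace sum_pidx exchange_big; apply: eq_bigr => s _.
by rewrite mxE.
Qed.

Lemma trace_idtens (a k : nat) (Y : 'M[C]_k) : \tr (idtens a Y) = a%:R * \tr Y.
Proof.
rewrite [LHS]/mxtrace sum_pidx (eq_bigr (fun=> \tr Y)).
  by rewrite sumr_const card_ord mulr_natl.
by move=> i _; apply: eq_bigr => s _; rewrite idtensE eqxx.
Qed.

(** No signalling: an operation on [A] cannot change the receiver's marginal, so all codewords share
    the same operator [I (x) rho_B]. *)
Lemma ptrA_lift_id (a k : nat) (Phi : 'M[C]_a -> 'M[C]_a) (X : 'M[C]_(a * k)) :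
  trace_preserving Phi -> ptrA (lift_id Phi k X) = ptrA X.
Proof.
by move=> tp; apply/matrixP => s t; rewrite !ptrA_block blockmx_lift_id tp.
Qed.

Lemma lift_id_comp (a k : nat) (Phi Psi : 'M[C]_a -> 'M[C]_a) (X : 'M[C]_(a * k)) :
  lift_id (Phi \o Psi) k X = lift_id Phi k (lift_id Psi k X).
Proof. by apply: tensor_matrixP => i j s t; rewrite !lift_idE blockmx_lift_id. Qed.

Lemma CPTP_state (a k : nat) (Phi : 'M[C]_a -> 'M[C]_a) (X : 'M[C]_(a * k)) :
  CPTP Phi -> is_state X -> is_state (lift_id Phi k X).
Proof.
case=> _ cp tp [pX trX]; split; first exact: cp.
by rewrite -trace_ptrA ptrA_lift_id// trace_ptrA.
Qed.

Lemma CPTP_comp (a : nat) (Phi Psi : 'M[C]_a -> 'M[C]_a) :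
  CPTP Phi -> CPTP Psi -> CPTP (Phi \o Psi).
Proof.
move=> [l1 c1 t1] [l2 c2 t2]; split.
- by move=> c X Y /=; rewrite l2 l1.
- by move=> k X pX; rewrite lift_id_comp; apply/c1/c2.
- by move=> X /=; rewrite t1 t2.
Qed.

Lemma CPTP_id (a : nat) : CPTP (id : 'M[C]_a -> 'M[C]_a).
Proof.
split=> // k X; suff -> : lift_id id k X = X by [].
by apply: tensor_matrixP => i j s t; rewrite lift_idE mxE.
Qed.

Definition conjmap (a : nat) (U Y : 'M[C]_a) : 'M[C]_a := U *m Y *m U^t*.

Definition tensid (a k : nat) (U : 'M[C]_a) : 'M[C]_(a * k) :=
  \matrix_(p, q) (U (unpair p).1 (unpair q).1 *+ ((unpair p).2 == (unpair q).2)).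

Lemma tensidE (a k : nat) (U : 'M[C]_a) i j s t :
  tensid k U (pidx i s) (pidx j t) = U i j *+ (s == t).
Proof. by rewrite mxE !pidxK. Qed.

Lemma tensid_adj (a k : nat) (U : 'M[C]_a) : (tensid k U)^t* = tensid k (U^t*).
Proof.
apply: tensor_matrixP => i j s t; rewrite conjmx_entry !tensidE conjmx_entry.
by rewrite rmorphMn eq_sym.
Qed.

Lemma tensid_mull (a k : nat) (U : 'M[C]_a) (X : 'M[C]_(a * k)) i p s :
  (tensid k U *m X) (pidx i s) p = \sum_j U i j * X (pidx j s) p.
Proof.
rewrite mxE sum_pidx; apply: eq_bigr => j _.
rewrite (bigD1 s)//= tensidE eqxx mulr1n big1 ?addr0// => t ts.
by rewrite tensidE eq_sym (negPf ts) mulr0n mul0r.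
Qed.

Lemma tensid_mulr (a k : nat) (U : 'M[C]_a) (X : 'M[C]_(a * k)) i p s :
  (X *m tensid k U) p (pidx i s) = \sum_j X p (pidx j s) * U j i.
Proof.
rewrite mxE sum_pidx; apply: eq_bigr => j _.
rewrite (bigD1 s)//= tensidE eqxx mulr1n big1 ?addr0// => t ts.
by rewrite tensidE (negPf ts) mulr0n mulr0.
Qed.

Lemma tensid_mul (a k : nat) (U V : 'M[C]_a) :
  tensid k U *m tensid k V = tensid k (U *m V).
Proof.
apply: tensor_matrixP => i j s t; rewrite tensid_mull tensidE mxE -sumrMnl.
by apply: eq_bigr => l _; rewrite tensidE mulrnAr.
Qed.

Lemma tensid1 (a k : nat) : tensid k (1%:M : 'M[C]_a) = 1%:M.
Proof.
apply: tensor_matrixP => i j s t; rewrite tensidE !mxE.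
have -> : (pidx i s == pidx j t) = (i == j) && (s == t).
  apply/eqP/andP => [e|[/eqP-> /eqP->]] //.
  by have := pidxK i s; rewrite e pidxK => -[-> ->].
by case: eqP; case: eqP.
Qed.

Lemma lift_id_conjmap (a k : nat) (U : 'M[C]_a) (X : 'M[C]_(a * k)) :
  lift_id (conjmap U) k X = tensid k U *m X *m (tensid k U)^t*.
Proof.
apply: tensor_matrixP => i j s t; rewrite lift_idE tensid_adj tensid_mulr mxE.
apply: eq_bigr => l _; rewrite tensid_mull mxE; congr (_ * _).
by apply: eq_bigr => m _; rewrite mxE.
Qed.

Lemma CPTP_conjmap (a : nat) (U : 'M[C]_a) :
  U^t* *m U = 1%:M -> CPTP (conjmap U).
Proof.
move=> UU; split.
- by move=> c X Y; rewrite /conjmap mulmxDr mulmxDl -scalemxAr -scalemxAl.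
- move=> k X pX; rewrite lift_id_conjmap -{1}[tensid k U]trmxCK.
  exact: psd_congr.
- by move=> X; rewrite /conjmap mxtrace_mulC mulmxA UU mul1mx.
Qed.

End TensorIndices.

(** * Real parts of complex traces, and averaging *)

Section RealPart.
Context {R : realType}.
Local Notation C := R[i].

Lemma ReD (x y : C) : complex.Re (x + y) = complex.Re x + complex.Re y.
Proof. by case: x y => [? ?] [? ?]. Qed.

Lemma ReN (x : C) : complex.Re (- x) = - complex.Re x.
Proof. by case: x. Qed.

Lemma Re_sum (I : Type) (r : seq I) (P : pred I) (F : I -> C) :
  complex.Re (\sum_(i <- r | P i) F i) = \sum_(i <- r | P i) complex.Re (F i).
Proof.
by apply: (big_rec2 (fun x y => complex.Re x = y)) => // i x y _ <-; rewrite ReD.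
Qed.

Lemma ReMr (r : R) (x : C) : complex.Re (r%:C%C * x) = r * complex.Re x.
Proof. by case: x => u v /=; rewrite mul0r subr0. Qed.

Lemma ReMn (n : nat) (x : C) : complex.Re (n%:R * x) = n%:R * complex.Re x.
Proof. by rewrite -ReMr rmorph_nat. Qed.

Lemma Re1 : complex.Re (1 : C) = 1. Proof. by []. Qed.

Lemma le_Re (x y : C) : x <= y -> complex.Re x <= complex.Re y.
Proof. by rewrite lecE => /andP[]. Qed.

Lemma exists_le_average (T : finType) (f : T -> R) (m : R) :
  (0 < #|T|)%N -> \sum_t f t <= #|T|%:R * m -> exists t, f t <= m.
Proof.
move=> /card_gt0P[t0 _] Hsum; apply/not_existsP => H.
suff : #|T|%:R * m < \sum_t f t by rewrite ltNge Hsum.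
rewrite mulr_natl -sumr_const; apply: ltr_sum.
  by apply/hasP; exists t0; rewrite ?mem_index_enum.
by move=> t _; rewrite ltNge; apply/negP/H.
Qed.

End RealPart.

(** * Twirling by signed permutations and the greedy code *)

Section Twirling.
Context {R : realType}.
Local Notation C := R[i].
Local Open Scope sesquilinear_scope.

(* Signed permutation matrices: a finite group of unitaries whose twirl is
   the completely depolarizing channel, as for the Weyl operators. *)
Definition signed_perm (a : nat) : finType := ({ffun 'I_a -> bool} * 'S_a)%type.

Definition sperm_mx (a : nat) (g : signed_perm a) : 'M[C]_a :=
  \matrix_(i, j) ((-1) ^+ g.1 i *+ (g.2 i == j)).

Lemma conjmap_sperm (a : nat) (g : signed_perm a) (Y : 'M[C]_a) i j :
  conjmap (sperm_mx g) Y i j = (-1) ^+ g.1 i * (-1) ^+ g.1 j * Y (g.2 i) (g.2 j).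
Proof.
have row (Z : 'M[C]_a) k l : (sperm_mx g *m Z) k l = (-1) ^+ g.1 k * Z (g.2 k) l.
  rewrite mxE (bigD1 (g.2 k))//= mxE eqxx mulr1n big1 ?addr0// => t tk.
  by rewrite mxE eq_sym (negPf tk) mulr0n mul0r.
rewrite /conjmap mxE (bigD1 (g.2 j))//= row big1 => [|t tj].
  by rewrite conjmx_entry mxE eqxx mulr1n rmorphXn rmorphN1 addr0 mulrAC.
by rewrite conjmx_entry [sperm_mx g j t]mxE eq_sym (negPf tj) mulr0n rmorph0 mulr0.
Qed.

Lemma sperm_unitary (a : nat) (g : signed_perm a) :
  (sperm_mx g)^t* *m sperm_mx g = 1%:M.
Proof.
apply: mulmx1C; rewrite -[X in X *m _]mulmx1; apply/matrixP => i j.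
rewrite [LHS]conjmap_sperm !mxE (inj_eq perm_inj); case: eqP => [->|_].
  by rewrite -signr_addb addbb mulr1.
by rewrite mulr0.
Qed.

(** Flipping the sign at [i] permutes the sign vectors and negates every term. *)
Lemma sum_sign_eq0 (a : nat) (i j : 'I_a) : i != j ->
  \sum_(e : {ffun 'I_a -> bool}) (-1) ^+ e i * (-1) ^+ e j = 0 :> C.
Proof.
move=> ij; apply/eqP; rewrite -eqNr; apply/eqP.
pose flip (e : {ffun 'I_a -> bool}) := [ffun x => e x (+) (x == i)].
have flipK : involutive flip.
  by move=> e; apply/ffunP => x; rewrite !ffunE -addbA addbb addbF.
rewrite [RHS](reindex_inj (can_inj flipK)) -sumrN; apply: eq_bigr => e _.
rewrite !ffunE eqxx eq_sym (negPf ij) addbF addbT.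
by rewrite signrN mulNr.
Qed.

(** Composing with a transposition shows that the sum does not depend on [i]; summed over all [i],
    each permutation contributes the trace. *)
Lemma sum_perm_diag (a : nat) (Y : 'M[C]_a) (i : 'I_a) :
  a%:R * \sum_(s : 'S_a) Y (s i) (s i) = #|'S_a|%:R * \tr Y.
Proof.
pose W j := \sum_(s : 'S_a) Y (s j) (s j).
have WW j : W j = W i.
  rewrite /W (reindex_inj (mulgI (tperm i j))); apply: eq_bigr => s _.
  by rewrite permM tpermR.
have : \sum_j W j = #|'S_a|%:R * \tr Y.
  rewrite exchange_big /= (eq_bigr (fun=> \tr Y)).
    by rewrite sumr_const mulr_natl.
  by move=> s _; rewrite /mxtrace [RHS](reindex_inj (@perm_inj _ s)).
by rewrite (eq_bigr (fun=> W i)) ?sumr_const ?card_ord ?mulr_natl.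
Qed.

(** The signs cancel the off-diagonal entries and the permutations equalize the diagonal ones. *)
Lemma twirl (a : nat) (Y : 'M[C]_a) :
  a%:R *: \sum_(g : signed_perm a) conjmap (sperm_mx g) Y
  = (#|signed_perm a|%:R * \tr Y)%:M.
Proof.
apply/matrixP => i j; rewrite mxE summxE.
rewrite (eq_bigr (fun g : signed_perm a => ((-1) ^+ g.1 i * (-1) ^+ g.1 j) * Y (g.2 i) (g.2 j)));
  last by move=> g _; rewrite conjmap_sperm.
rewrite -(pair_bigA _ (fun (e : {ffun 'I_a -> bool}) (s : 'S_a) =>
  ((-1) ^+ e i * (-1) ^+ e j) * Y (s i) (s j))) /=.
rewrite -big_distrlr /= mxE; case: eqP => [<-|/eqP ij]; last first.
  by rewrite sum_sign_eq0// mul0r mulr0.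
rewrite mulrCA sum_perm_diag (eq_bigr (fun=> 1)); last first.
  by move=> e _; rewrite -signr_addb addbb.
by rewrite sumr_const mulrA -natrM mulr1n card_prod.
Qed.

Lemma twirl_lift (a k : nat) (X : 'M[C]_(a * k)) :
  a%:R *: \sum_(g : signed_perm a) lift_id (conjmap (sperm_mx g)) k X
  = #|signed_perm a|%:R *: idtens a (ptrA X).
Proof.
apply: tensor_matrixP => i j s t.
have := congr1 (fun Z : 'M[C]_a => Z i j) (twirl (blockmx X s t)).
rewrite /= mxE summxE [RHS]mxE => tw.
rewrite mxE summxE (eq_bigr (fun g => conjmap (sperm_mx g) (blockmx X s t) i j)).
  by rewrite tw [RHS]mxE idtensE ptrA_block; case: eqP; rewrite ?mulr0.
by move=> g _; rewrite lift_idE.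
Qed.

Lemma card_signed_perm_gt0 (a : nat) : (0 < #|signed_perm a|)%N.
Proof. by apply/card_gt0P; exists ([ffun=> false], 1%g). Qed.

(** By [twirl_lift] this operator is a nonnegative multiple of a sum of unitary conjugates of
    [X]. *)
Lemma idtens_ptrA_psd (a k : nat) (X : 'M[C]_(a * k)) : psd X ->
  psd (idtens a (ptrA X)).
Proof.
move=> pX; have G0 : (#|signed_perm a|%:R : C) != 0.
  by rewrite pnatr_eq0 -lt0n card_signed_perm_gt0.
rewrite -[idtens _ _]scale1r -(mulVf G0) -scalerA -twirl_lift.
apply: psd_scale; first by rewrite invr_ge0 ler0n.
apply: psd_scale; first by rewrite ler0n.
apply: psd_sum => g _; have [_ cp _] := CPTP_conjmap (sperm_unitary g).
exact: cp.
Qed.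

Lemma lift_conjmap_idtens (a k : nat) (U : 'M[C]_a) (Y : 'M[C]_k) :
  U *m U^t* = 1%:M -> lift_id (conjmap U) k (idtens a Y) = idtens a Y.
Proof.
move=> UU; apply: tensor_matrixP => i j s t.
rewrite lift_idE blockmx_idtens idtensE /conjmap mul_mx_scalar -scalemxAl UU.
by rewrite !mxE; case: eqP; rewrite ?mulr1 ?mulr0.
Qed.

Lemma tensid_unitary (a k : nat) (U : 'M[C]_a) : U^t* *m U = 1%:M ->
  (tensid k U)^t* *m tensid k U = 1%:M.
Proof. by move=> UU; rewrite tensid_adj tensid_mul UU tensid1. Qed.

Lemma trace_lift_conjmap (a k : nat) (U : 'M[C]_a) (X Y : 'M[C]_(a * k)) :
  U^t* *m U = 1%:M ->
  \tr (lift_id (conjmap U) k X *m lift_id (conjmap U) k Y) = \tr (X *m Y).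
Proof.
move=> /(tensid_unitary k); rewrite !lift_id_conjmap; move: (tensid k U) => W WW.
rewrite !mulmxA -(mulmxA _ (W^t*) W) WW mulmx1 -!mulmxA mxtrace_mulC !mulmxA.
by rewrite -(mulmxA _ (W^t*) W) WW mulmx1.
Qed.

Lemma proj_lift_conjmap (a k : nat) (U : 'M[C]_a) (P : 'M[C]_(a * k)) :
  U^t* *m U = 1%:M -> is_proj P -> is_proj (lift_id (conjmap U) k P).
Proof.
move=> /(tensid_unitary k); rewrite !lift_id_conjmap; move: (tensid k U) => W WW.
move=> [hP eP]; split; first by rewrite !conjmx_mul trmxCK hP mulmxA.
by rewrite !mulmxA -(mulmxA _ (W^t*) W) WW mulmx1 -(mulmxA _ P P) eP.
Qed.

Lemma Re_trace_sum (n : nat) (I : Type) (r : seq I) (P : pred I) (F : I -> 'M[C]_n) :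
  complex.Re (\tr (\sum_(i <- r | P i) F i))
  = \sum_(i <- r | P i) complex.Re (\tr (F i)).
Proof. by rewrite -Re_sum; congr (complex.Re _); apply: raddf_sum. Qed.

Lemma exists_le_twirl (a k : nat) (X B : 'M[C]_(a * k)) : (0 < a)%N ->
  exists g : signed_perm a,
    complex.Re (\tr (lift_id (conjmap (sperm_mx g)) k X *m B))
    <= complex.Re (\tr (idtens a (ptrA X) *m B)) / a%:R.
Proof.
move=> a0; have aR : (a%:R : R) != 0 by rewrite pnatr_eq0 -lt0n.
apply: exists_le_average; first exact: card_signed_perm_gt0.
have := congr1 (fun Z => complex.Re (\tr (Z *m B))) (twirl_lift X).
rewrite /= -!scalemxAl !mxtraceZ !ReMn mulmx_suml Re_trace_sum => tw.
rewrite le_eqVlt; apply/orP; left; apply/eqP.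
by apply: (mulfI aR); rewrite tw mulrCA (mulrCA a%:R) divff// mulr1.
Qed.

(* The unitaries are chosen one after the other, each of them below the average
   over the group; this replaces the usual random coding argument. *)
Lemma greedy_code (a k : nat) (X P : 'M[C]_(a * k)) (M : nat) : (0 < a)%N ->
  exists g : nat -> signed_perm a, forall i, (i < M)%N ->
    complex.Re (\tr (lift_id (conjmap (sperm_mx (g i))) k X
      *m \sum_(j < i) lift_id (conjmap (sperm_mx (g j))) k P))
    <= i%:R * complex.Re (\tr (idtens a (ptrA X) *m P)) / a%:R.
Proof.
move=> a0; elim: M => [|M [g Hg]].
  by exists (fun=> ([ffun=> false], 1%g)).
have [h Hh] := exists_le_twirl X
  (\sum_(j < M) lift_id (conjmap (sperm_mx (g j))) k P) a0.
(* The bound at [i] involves only the unitaries up to [i], so the earlier choices keep theirs. *)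
exists (fun i => if i == M then h else g i) => i; rewrite ltnS => iM.
rewrite (eq_bigr (fun j : 'I_i => lift_id (conjmap (sperm_mx (g j))) k P)); last first.
  by move=> j _; rewrite ltn_eqF// (leq_trans (ltn_ord j)).
case: eqP => [->|/eqP neq]; last by apply: Hg; rewrite ltn_neqAle neq.
apply: le_trans Hh _; rewrite mulmx_sumr Re_trace_sum.
rewrite (eq_bigr (fun=> complex.Re (\tr (idtens a (ptrA X) *m P)))).
  by rewrite sumr_const card_ord mulr_natl.
(* [I (x) tau_B] is invariant under conjugation by the unitary, so each conjugated test has the same
   trace against it as [P]. *)
move=> j _; have U := sperm_unitary (g j).
rewrite -[in LHS](lift_conjmap_idtens (U := sperm_mx (g j)) (ptrA X) (mulmx1C U)).
by rewrite trace_lift_conjmap.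
Qed.

End Twirling.

(** * One-shot direct and converse bounds *)

Section OneShot.
Context {R : realType}.
Local Notation C := R[i].
Local Open Scope sesquilinear_scope.

(** The operator [X(g)], with a free parameter [x] in place of [e^(-n g)]. *)
Definition excess (a k : nat) (x : R) (tau : 'M[C]_(a * k)) : 'M[C]_(a * k) :=
  tau - (x%:C)%C *: idtens a (ptrA tau).

Lemma Re_trB (n : nat) (A B : 'M[C]_n) :
  complex.Re (\tr (A - B)) = complex.Re (\tr A) - complex.Re (\tr B).
Proof. by rewrite mxtraceD -scaleN1r mxtraceZ mulN1r ReD ReN. Qed.

Lemma Re_trD (n : nat) (A B : 'M[C]_n) :
  complex.Re (\tr (A + B)) = complex.Re (\tr A) + complex.Re (\tr B).
Proof. by rewrite mxtraceD ReD. Qed.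

Lemma realC_ge0 (x : R) : 0 <= x -> 0 <= (x%:C)%C :> C.
Proof. by rewrite ler0c. Qed.

Lemma excess_herm (a k : nat) (x : R) (tau : 'M[C]_(a * k)) :
  0 <= x -> psd tau -> (excess x tau)^t* = excess x tau.
Proof.
move=> x0 pt; rewrite conjmx_sub (psd_herm pt) (psd_herm (psd_scale _ _)) //.
  exact: realC_ge0.
exact: idtens_ptrA_psd.
Qed.

Lemma posproj_excess_bounds (a k : nat) (x : R) (tau : 'M[C]_(a * k)) :
  0 <= x -> is_state tau ->
  let P := posproj (excess x tau) in
  [/\ complex.Re (\tr (P *m excess x tau)) <= complex.Re (\tr (tau *m P)),
      complex.Re (\tr (tau *m P)) <= 1 &
      x * complex.Re (\tr (idtens a (ptrA tau) *m P)) <= 1].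
Proof.
move=> x0 [pt trt] P; have hP : is_proj P := posproj_proj _.
have pP := proj_psd hP; have pQ := proj_psd (proj_compl hP).
have pY := idtens_ptrA_psd pt.
have E : complex.Re (\tr (P *m excess x tau)) = complex.Re (\tr (tau *m P))
    - x * complex.Re (\tr (idtens a (ptrA tau) *m P)).
  by rewrite mxtrace_mulC mulmxBl Re_trB -scalemxAl mxtraceZ ReMr.
have le1 : complex.Re (\tr (tau *m P)) <= 1.
  have := le_Re (psd_trace_mul_ge0 pt pQ).
  by rewrite mulmxBr mulmx1 Re_trB trt Re1 subr_ge0.
(* Maximality of [P] against the competitor [E = 0]; together with [le1] this yields the third
   bound. *)
have ge0 : 0 <= complex.Re (\tr (P *m excess x tau)).
  have := trace_le_posproj (excess_herm x0 pt) (@psd_0 R _).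
  by rewrite subr0 mulmx0 mxtrace0 => /(_ (@psd_1 R _))/le_Re.
have Y0 := le_Re (psd_trace_mul_ge0 pY pP); rewrite /= in Y0.
by split=> //; rewrite E in ge0 *; nra.
Qed.

Lemma seqdec_error (n : nat) (rho : 'M[C]_n) (Q : nat -> 'M[C]_n) (i : nat) :
  is_state rho -> (forall i, is_proj (Q i)) ->
  1 - complex.Re (\tr (rho *m seqdec Q i))
  <= 4%:R * (complex.Re (\tr (rho *m \sum_(j < i) Q j))
             + (1 - complex.Re (\tr (rho *m Q i)))).
Proof.
move=> [prho trrho] hQ.
have := le_Re (psd_trace_mul_ge0 prho (seqdec_union_bound i hQ)).
move: (seqdec Q i) (\sum_(j < i) Q j) (Q i) => D S P.
rewrite mulmxBr -scalemxAr mulmxDr !mulmxBr !mulmx1 Re_trB mxtraceZ ReMn Re_trD.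
by rewrite (Re_trB rho) (Re_trB rho) trrho Re1 subr_ge0.
Qed.

(** Codeword [i] fails its own test as often as [tau] fails [P]. The [i] earlier tests contribute at
    most [i / (a x)] in all, by the greedy choice and the third bound of [posproj_excess_bounds].
    The union bound costs the factor 4. *)
Lemma oneshot_achievability (a k M : nat) (x : R) (tau : 'M[C]_(a * k)) :
  (0 < a)%N -> 0 < x -> is_state tau ->
  exists (enc : 'I_M -> 'M[C]_a -> 'M[C]_a) (dec : 'I_M -> 'M[C]_(a * k)),
    [/\ forall i, CPTP (enc i), forall i, psd (dec i),
        psd (1%:M - \sum_i dec i) &
        forall i, 1 - complex.Re (\tr (lift_id (enc i) k tau *m dec i))
          <= 4%:R * (1 - complex.Re (\tr (posproj (excess x tau) *m excess x tau))
                     + i%:R / (a%:R * x))].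
Proof.
move=> a0 x0 st; have [b1 b2 b3] := posproj_excess_bounds (ltW x0) st.
set P := posproj _ in b1 b2 b3 *.
have hP : is_proj P := posproj_proj _.
have [g Hg] := greedy_code tau P M a0.
pose Q j := lift_id (conjmap (sperm_mx (g j))) k P.
have hQ j : is_proj (Q j) by apply: proj_lift_conjmap => //; apply: sperm_unitary.
have cptp j : CPTP (conjmap (sperm_mx (g j)) : 'M[C]_a -> 'M[C]_a).
  exact/CPTP_conjmap/sperm_unitary.
exists (fun i => conjmap (sperm_mx (g i))), (seqdec Q); split=> //.
- by move=> i; apply: psd_seqdec.
- exact: psd_sum_seqdec.
move=> i; set rho := lift_id _ _ _; move: b1 b2 b3.
set u := complex.Re (\tr (P *m excess x tau)).
set v := complex.Re (\tr (tau *m P)); set c := complex.Re _ => b1 b2 b3.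
have [prho trrho] : is_state rho by apply: CPTP_state.
apply: le_trans (seqdec_error i (conj prho trrho) hQ) _.
rewrite ler_pM2l ?ltr0n// [leLHS]addrC lerD//.
  by rewrite lerD2l lerN2 /rho trace_lift_conjmap// sperm_unitary.
apply: le_trans (Hg i (ltn_ord i)) _; rewrite -/c -mulrA.
rewrite ler_wpM2l// invfM [leRHS]mulrC ler_wpM2r ?invr_ge0//.
by rewrite -[leRHS]mul1r ler_pdivlMr// mulrC.
Qed.

Lemma psd_compl_summand (n M : nat) (E : 'I_M -> 'M[C]_n) (i : 'I_M) :
  (forall i, psd (E i)) -> psd (1%:M - \sum_i E i) -> psd (1%:M - E i).
Proof.
move=> pE pS; have -> : 1%:M - E i = (1%:M - \sum_i E i) + \sum_(j | j != i) E j.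
  by rewrite [in RHS](bigD1 i)//= opprD addrA subrK.
by apply: psd_add => //; apply: psd_sum.
Qed.

Lemma avg_error_ge0 (a k M : nat) (rho : 'M[C]_(a * k))
    (enc : 'I_M -> 'M[C]_a -> 'M[C]_a) (dec : 'I_M -> 'M[C]_(a * k)) :
  is_state rho -> (forall i, CPTP (enc i)) -> (forall i, psd (dec i)) ->
  psd (1%:M - \sum_i dec i) -> 0 <= avg_error rho enc dec.
Proof.
move=> st cptp pd ps; rewrite mulr_ge0 ?invr_ge0// sumr_ge0// => i _.
have [pr trr] := CPTP_state (cptp i) st.
have := le_Re (psd_trace_mul_ge0 pr (psd_compl_summand i pd ps)).
by rewrite mulmxBr mulmx1 Re_trB trr.
Qed.

(** [Lam] is absorbed into every encoder, applied before the unitary. With [m.+1] codewords the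
    indices run only up to [m], which is why the last term has [m]. *)
Lemma oneshot_direct (a k m : nat) (x : R) (rho : 'M[C]_(a * k))
    (Lam : 'M[C]_a -> 'M[C]_a) :
  (0 < a)%N -> 0 < x -> is_state rho -> CPTP Lam ->
  exists (enc : 'I_m.+1 -> 'M[C]_a -> 'M[C]_a) (dec : 'I_m.+1 -> 'M[C]_(a * k)),
    [/\ forall i, CPTP (enc i), forall i, psd (dec i),
        psd (1%:M - \sum_i dec i) &
        avg_error rho enc dec
          <= 4%:R * (1 - complex.Re (\tr (posproj (excess x (lift_id Lam k rho))
                                          *m excess x (lift_id Lam k rho)))
                     + m%:R / (a%:R * x))].
Proof.
move=> a0 x0 st cptp; have st' := CPTP_state cptp st.
have [enc [dec [h1 h2 h3 h4]]] := oneshot_achievability m.+1 a0 x0 st'.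
exists (fun i => enc i \o Lam), dec; split=> // [i|]; first exact: CPTP_comp.
rewrite ler_pdivrMl ?ltr0n//; set B := 4%:R * _.
rewrite mulr_natl -[X in B *+ X]card_ord -sumr_const.
apply: ler_sum => i _; rewrite lift_id_comp; apply: le_trans (h4 i) _.
rewrite /B; move: (1 - _) => u.
have im : i%:R <= m%:R :> R by rewrite ler_nat -ltnS ltn_ord.
have ax : 0 <= (a%:R * x)^-1 by rewrite invr_ge0 mulr_ge0 ?ler0n ?(ltW x0).
by rewrite ler_pM2l ?ltr0n// lerD2l; apply: ler_wpM2r.
Qed.

Lemma oneshot_converse (a k M : nat) (x : R) (rho : 'M[C]_(a * k))
    (enc : 'I_M -> 'M[C]_a -> 'M[C]_a) (dec : 'I_M -> 'M[C]_(a * k)) :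
  (0 < M)%N -> 0 <= x -> is_state rho ->
  (forall i, CPTP (enc i)) -> (forall i, psd (dec i)) ->
  psd (1%:M - \sum_i dec i) ->
  exists i, 1 - avg_error rho enc dec - x * a%:R / M%:R
    <= complex.Re (\tr (posproj (excess x (lift_id (enc i) k rho))
                        *m excess x (lift_id (enc i) k rho))).
Proof.
move=> M0 x0 st cptp pd ps; have MR : (M%:R : R) != 0 by rewrite pnatr_eq0 -lt0n.
pose rh i := lift_id (enc i) k rho.
have strh i : is_state (rh i) by apply: CPTP_state.
pose Y := idtens a (ptrA rho).
have pY : psd Y by apply: idtens_ptrA_psd; case: st.
have ptrE i : ptrA (rh i) = ptrA rho by apply: ptrA_lift_id; case: (cptp i).
(* The decoding operators sum to at most the identity, and [I (x) rho_B] has trace [a]. *)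
have sumY : \sum_i complex.Re (\tr (Y *m dec i)) <= a%:R.
  have := le_Re (psd_trace_mul_ge0 pY ps); rewrite mulmxBr mulmx1 Re_trB.
  rewrite mulmx_sumr Re_trace_sum trace_idtens trace_ptrA; case: st => _ ->.
  by rewrite mulr1 -[X in X - _]/(complex.Re _) -[a%:R]mulr1 ReMn mulr1 subr_ge0.
(* Each decoding operator competes with the spectral projection of its codeword. *)
have lb i : complex.Re (\tr (rh i *m dec i)) - x * complex.Re (\tr (Y *m dec i))
    <= complex.Re (\tr (posproj (excess x (rh i)) *m excess x (rh i))).
  have [pr _] := strh i.
  have := le_Re (trace_le_posproj (excess_herm x0 pr) (pd i) (psd_compl_summand i pd ps)).
  by rewrite {1}/excess mulmxBl Re_trB -scalemxAl mxtraceZ ReMr ptrE.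
set e := avg_error _ _ _.
have eE : \sum_i complex.Re (\tr (rh i *m dec i)) = M%:R * (1 - e).
  rewrite /e /avg_error sumrB sumr_const card_ord mulrBr mulr1 mulrA mulfV// mul1r.
  by rewrite opprB addrC subrK.
(* Averaging the negated values produces a codeword whose value is at least the mean. *)
have [||i Hi] := @exists_le_average R 'I_M
  (fun i => - complex.Re (\tr (posproj (excess x (rh i)) *m excess x (rh i))))
  (- (1 - e - x * a%:R / M%:R)).
- by rewrite card_ord.
- rewrite sumrN mulrN lerN2 card_ord.
  apply: le_trans (ler_sum _ (fun i _ => lb i)).
  rewrite sumrB eE mulrBr lerD2l lerN2 -mulr_sumr mulrCA mulfV// mulr1.
  exact: ler_wpM2l.
by exists i; move: Hi; rewrite lerN2.
Qed.

End OneShot.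

(** * Lower limits and exponential sequences *)

Section LimitInferior.
Context {R : realType}.

Lemma cvg_limn_einf (u : nat -> R) (l : R) : u @ \oo --> l ->
  limn_einf (fun n => (u n)%:E) = l%:E.
Proof.
move=> ul; have ul' : (u n)%:E @[n --> \oo] --> l%:E.
  by apply: cvg_EFin ul; apply: nearW.
by have [-> _] := cvg_limn_einf_sup ul'.
Qed.

(** The lower limit is the supremum of the tail infima, so some tail infimum already exceeds
    [l - e]. *)
Lemma limn_einf_near (u : nat -> R) (l e : R) : 0 < e ->
  limn_einf (fun n => (u n)%:E) = l%:E -> \forall n \near \oo, l - e < u n.
Proof.
move=> e0; rewrite limn_einf_lim.
rewrite (cvg_lim _ (@cvg_einfs_sup R (fun n => (u n)%:E))) // => supE.
have : ((l - e)%:E < ereal_sup (range (einfs (fun n => (u n)%:E))))%E.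
  by rewrite supE lte_fin ltrBlDr ltrDl.
move=> /ereal_sup_gt[_ [N _ <-] lN].
exists N => // n /= Nn; rewrite -lte_fin; apply: lt_le_trans lN _.
by apply: ereal_inf_lbound; exists n.
Qed.

(** Turns the lower limit 1 of the test values, which are bounded by 1, into a genuine limit. *)
Lemma limn_einf_cvg (u : nat -> R) (l : R) :
  (\forall n \near \oo, u n <= l) -> limn_einf (fun n => (u n)%:E) = l%:E ->
  u @ \oo --> l.
Proof.
move=> ul einf; apply/cvgrPdist_lt => e e0.
have lu := limn_einf_near e0 einf.
near=> n; have un : u n <= l by near: n.
rewrite ger0_norm ?subr_ge0// ltrBlDr -ltrBlDl; near: n; exact: lu.
Unshelve. all: by end_near. Qed.

Lemma cvg_expRn (e : R) : 0 < e -> expR (- (n%:R * e)) @[n --> \oo] --> (0 : R).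
Proof.
move=> e0; rewrite (_ : (fun n => _) = fun n => expR (- e) ^+ n).
  by apply: cvg_expr; rewrite ger0_norm ?expR_ge0// -expR0 ltr_expR oppr_lt0.
by apply/funext => n; rewrite -mulrN expRM_natl.
Qed.

Lemma natr_exp_expR (d n : nat) : (0 < d)%N ->
  (d ^ n)%:R = expR (n%:R * ln d%:R) :> R.
Proof. by move=> d0; rewrite expRM_natl lnK ?natrX// posrE ltr0n. Qed.

End LimitInferior.

(** * Asymptotic converse and direct part, and the capacity formula *)

Section DenseCoding.
Context {R : realType}.
Local Notation C := R[i].

Definition test_value (a b : nat -> nat) (tau : forall n, 'M[C]_(a n * b n))
    (g : R) (n : nat) : R :=
  complex.Re (\tr (posproj (excess (expR (- (n%:R * g))) (tau n))
                   *m excess (expR (- (n%:R * g))) (tau n))).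

Lemma test_value_le1 (a b : nat -> nat) (tau : forall n, 'M[C]_(a n * b n)) (g : R) n :
  is_state (tau n) -> test_value tau g n <= 1.
Proof.
by move=> /(posproj_excess_bounds (expR_ge0 (- (n%:R * g))))[+ + _]; apply: le_trans.
Qed.

Variables (d : nat) (dB : nat -> nat) (rho : forall n, 'M[C]_(d ^ n * dB n)).
Hypothesis d_gt0 : (0 < d)%N.
Hypothesis rho_state : forall n, (0 < n)%N -> is_state (rho n).

Lemma dn_gt0 n : (0 < d ^ n)%N. Proof. by rewrite expn_gt0 d_gt0. Qed.

Lemma achievable_test (r e : R) : achievable_rate d dB rho r -> 0 < e ->
  exists2 Lam : forall n, 'M[C]_(d ^ n) -> 'M[C]_(d ^ n), (forall n, CPTP (Lam n)) &
    limn_einf (fun n => (test_value (a := fun n => (d ^ n)%N)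
      (fun n => lift_id (Lam n) (dB n) (rho n)) (ln d%:R - r + e) n)%:E) = 1%E.
Proof.
move=> [M [enc [dec [cptp pd ps Mbig err]]]] e0.
pose x n : R := expR (- (n%:R * (ln d%:R - r + e))).
(* The best encoder serves as [Lambda_n]; the identity fills in at [n = 0] and where the code is
   empty, which happens for finitely many [n] only. *)
have H n : {L : 'M[C]_(d ^ n) -> 'M[C]_(d ^ n) | CPTP L /\
    ((0 < n)%N -> (0 < M n)%N ->
      1 - avg_error (rho n) (enc n) (dec n) - x n * (d ^ n)%:R / (M n)%:R
      <= complex.Re (\tr (posproj (excess (x n) (lift_id L (dB n) (rho n)))
            *m excess (x n) (lift_id L (dB n) (rho n)))))}.
  apply: cid; have [n0|] := boolP (0 < n)%N; last by exists id; split=> //; exact: CPTP_id.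
  have [M0|] := boolP (0 < M n)%N; last by exists id; split=> //; exact: CPTP_id.
  have [i Hi] := oneshot_converse M0 (expR_ge0 _ : 0 <= x n)
    (rho_state n0) (cptp n) (pd n) (ps n).
  by exists (enc n i); split.
exists (fun n => sval (H n)); first by move=> n; case: (svalP (H n)).
apply: cvg_limn_einf.
have lo : 1 - avg_error (rho n) (enc n) (dec n) - expR (- (n%:R * e))
    @[n --> \oo] --> (1 : R).
  rewrite -[X in _ --> X]subr0 -[X in _ --> X - _]subr0.
  apply: cvgB; last exact: cvg_expRn.
  by apply: cvgB => //; exact: cvg_cst.
apply: squeeze_cvgr; last exact: cvg_cst; last exact: lo.
near=> n => /=.
have n0 : (0 < n)%N by near: n; exists 1%N.
have Mn : expR (n%:R * r) <= (M n)%:R by near: n.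
have M0 : (0 < M n)%N by rewrite -(ltr0n R); apply: lt_le_trans Mn; exact: expR_gt0.
have [L1 L2] := svalP (H n).
apply/andP; split; last exact/test_value_le1/CPTP_state/rho_state.
(* The correction [x d^n / M] is at most [e^(-n e)], because [x d^n = e^(n r) e^(-n e)] and
   [M >= e^(n r)]. *)
apply: le_trans (L2 n0 M0); rewrite lerD2l lerN2 ler_pdivrMr ?ltr0n//.
apply: le_trans (ler_wpM2l (expR_ge0 _) Mn).
rewrite natr_exp_expR// /x -!expRD ler_expR; lra.
Unshelve. all: by end_near. Qed.

Lemma test_achievable (Lam : forall n, 'M[C]_(d ^ n) -> 'M[C]_(d ^ n)) (g r : R) :
  (forall n, CPTP (Lam n)) ->
  limn_einf (fun n => (test_value (a := fun n => (d ^ n)%N)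
      (fun n => lift_id (Lam n) (dB n) (rho n)) g n)%:E) = 1%E ->
  r < ln d%:R - g -> achievable_rate d dB rho r.
Proof.
move=> cptp einf rg.
set tau := fun n => lift_id (Lam n) (dB n) (rho n) in einf *.
have test1 : test_value (a := fun n => (d ^ n)%N) tau g n @[n --> \oo] --> (1 : R).
  apply: limn_einf_cvg einf; exists 1%N => // n /= n0.
  exact/test_value_le1/CPTP_state/rho_state.
pose x n : R := expR (- (n%:R * g)).
(* The code has [m + 1] words: [m + 1 > e^(n r)] gives the rate, while [m <= e^(n r)] bounds the
   error. *)
pose m n : nat := Num.truncn (expR (n%:R * r)).
pose T n := 'M[C]_(d ^ n).
have H n : {c : ('I_(m n).+1 -> T n -> T n) * ('I_(m n).+1 -> 'M[C]_(d ^ n * dB n)) |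
    [/\ forall i, CPTP (c.1 i), forall i, psd (c.2 i),
        psd (1%:M - \sum_i c.2 i) &
        (0 < n)%N -> avg_error (rho n) c.1 c.2
          <= 4%:R * (1 - test_value (a := fun n => (d ^ n)%N) tau g n
                     + (m n)%:R / ((d ^ n)%:R * x n))]}.
  apply: cid; have [n0|_] := boolP (0 < n)%N; last first.
    (* [rho 0] need not be a state, so index 0 gets a dummy code. *)
    exists (fun=> id, fun=> 0); split=> //=.
    - by move=> _; exact: CPTP_id.
    - by move=> _; exact: psd_0.
    - by rewrite big1// subr0; apply: psd_1.
  have [enc [dec [h1 h2 h3 h4]]] :=
    oneshot_direct (m n) (dn_gt0 n) (expR_gt0 _ : 0 < x n) (rho_state n0) (cptp n).
  by exists (enc, dec); split.
exists (fun n => (m n).+1), (fun n => (sval (H n)).1), (fun n => (sval (H n)).2).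
split.
- by move=> n i; case: (svalP (H n)).
- by move=> n i; case: (svalP (H n)).
- by move=> n; case: (svalP (H n)).
- by apply: nearW => n; apply: ltW; apply: truncnS_gt.
(* The term [m / (d^n x)] is at most [e^(-n (log d - g - r))], which vanishes since
   [r < log d - g]. *)
have hi : 4%:R * (1 - test_value (a := fun n => (d ^ n)%N) tau g n
    + expR (- (n%:R * (ln d%:R - g - r)))) @[n --> \oo] --> (0 : R).
  rewrite -[X in _ --> X](mulr0 4%:R); apply: cvgMr.
  rewrite -[X in _ --> X]addr0; apply: cvgD; last by apply: cvg_expRn; lra.
  by rewrite -[X in _ --> X](subrr 1); apply: cvgB => //; exact: cvg_cst.
apply: squeeze_cvgr; last exact: hi; last exact: cvg_cst.
near=> n => /=.
have n0 : (0 < n)%N by near: n; exists 1%N.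
have [h1 h2 h3 h4] := svalP (H n).
apply/andP; split; first exact: (avg_error_ge0 (rho_state n0) h1 h2 h3).
apply: le_trans (h4 n0) _; rewrite ler_pM2l ?ltr0n// lerD2l.
rewrite ler_pdivrMr; last by rewrite mulr_gt0 ?expR_gt0 ?ltr0n ?dn_gt0.
apply: (@le_trans _ _ (expR (n%:R * r))); first by rewrite -truncn_ge_nat ?expR_ge0.
by rewrite natr_exp_expR// /x -!expRD ler_expR; lra.
Unshelve. all: by end_near. Qed.

End DenseCoding.

(** As [l] is finite this holds at infinite [x] too, so [l - _] can be moved across inequalities
    between extended reals. *)
Lemma subKe (R : realType) (l : R) (x : \bar R) : (l%:E - (l%:E - x))%E = x.
Proof. by case: x => [x||] //=; rewrite -!EFinB subKr. Qed.

Theorem theorem4 (R : realType) (d : nat) (dB : nat -> nat)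
  (rho : forall n, 'M[R[i]]_(d ^ n * dB n)) :
  (0 < d)%N ->
  (forall n, (0 < n)%N -> is_state (rho n)) ->
  dense_coding_capacity d dB rho =
  ((ln (d%:R : R))%:E -
   ereal_inf [set sup_entropy_rate (fun n => (d ^ n)%N) dB
                 (fun n => lift_id (Lam n) (dB n) (rho n))
             | Lam in [set Lam : forall n, 'M[R[i]]_(d ^ n) -> 'M[R[i]]_(d ^ n)
                       | forall n, CPTP (Lam n)]])%E.
Proof.
move=> d0 st; apply/eqP; rewrite eq_le; apply/andP; split.
  (* Converse: for achievable [r] and any [e > 0], some [Lam] has [log d - r + e] in the set
     defining its entropy rate, so the infimum is at most [log d - r]. *)
  apply: ge_ereal_sup => _ [r ach <-].
  rewrite -[leLHS](subKe (ln d%:R)); apply: leeB => //; rewrite -EFinB.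
  apply/lee_addgt0Pr => e e0; rewrite -EFinD.
  have [Lam cptp einf] := achievable_test d0 st ach e0.
  apply: (@le_trans _ _ (sup_entropy_rate (fun n => (d ^ n)%N) dB
    (fun n => lift_id (Lam n) (dB n) (rho n)))); apply: ereal_inf_lbound.
    by exists Lam.
  by exists (ln d%:R - r + e).
(* Direct part: it suffices that [log d - C_DC] is at most every [g] admissible for some [Lam]; this
   follows because [log d - g - e] is achievable for all [e > 0]. *)
rewrite -[leRHS](subKe (ln d%:R)); apply: leeB => //.
apply: le_ereal_inf_tmp => _ [Lam cptp <-].
apply: le_ereal_inf_tmp => _ [g einf <-].
rewrite -[leRHS](subKe (ln d%:R)); apply: leeB => //; rewrite -EFinB.
apply/lee_addgt0Pr => e e0; rewrite -leeBlDr// -EFinB.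
apply: ereal_sup_ubound; exists (ln d%:R - g - e) => //.
by apply: (test_achievable d0 st cptp einf); rewrite ltrBlDr ltrDl.
Qed.
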